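(* Let $\mathcal W$ be a class of objects of the extriangulated category $(\mathcal C,\mathbb E,\mathfrak s)$ that is closed under isomorphisms and finite direct sums. Then: (1) $\mathcal{GW}^n(\xi)=\mathcal{GW}(\xi)$ for any $n\geq 1$; (2) $\mathcal{GW}(\xi)$ is closed under direct summands.
   Context: Extriangulated categories (Nakaoka–Palu). Let $\mathcal C$ be an additive category with an additive bifunctor $\mathbb E:\mathcal C^{\mathrm{op}}\times\mathcal C\to\mathrm{Ab}$. For $\delta\in\mathbb E(C,A)$, $a:A\to A'$, $c:C'\to C$ write $a_*\delta=\mathbb E(C,a)(\delta)$, $c^*\delta=\mathbb E(c,A)(\delta)$. For $\delta\in\mathbb E(C,A)$, $\delta'\in\mathbb E(C',A')$, a morphism $(a,c):\delta\to\delta'$ is a pair $a:A\to A'$, $c:C\to C'$ with $a_*\delta=c^*\delta'$. Two sequences $A\xrightarrow{x}B\xrightarrow{y}C$ and $A\xrightarrow{x'}B'\xrightarrow{y'}C$ are equivalent if there is an isomorphism $b:B\to B'$ with $bx=x'$, $y'b=y$. A realization $\mathfrak s$ assigns to each $\delta\in\mathbb E(C,A)$ an equivalence class $\mathfrak s(\delta)=[A\xrightarrow{x}B\xrightarrow{y}C]$ such that for every morphism $(a,c):\delta\to\delta'$ with $\mathfrak s(\delta)=[A\xrightarrow{x}B\xrightarrow{y}C]$, $\mathfrak s(\delta')=[A'\xrightarrow{x'}B'\xrightarrow{y'}C']$ there is $b:B\to B'$ with $bx=x'a$, $y'b=cy$. It is additive if $\mathfrak s(0)=[A\to A\oplus C\to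 C]$ (canonical maps) and $\mathfrak s(\delta\oplus\delta')=\mathfrak s(\delta)\oplus\mathfrak s(\delta')$. If $\mathfrak s(\delta)=[A\xrightarrow{x}B\xrightarrow{y}C]$, one calls $A\xrightarrow{x}B\xrightarrow{y}C\overset{\delta}{\dashrightarrow}$ an $\mathbb E$-triangle, $x$ an inflation and $y$ a deflation. $(\mathcal C,\mathbb E,\mathfrak s)$ is extriangulated if $\mathfrak s$ is an additive realization and: (ET3) for $\mathbb E$-triangles $A\xrightarrow{x}B\xrightarrow{y}C\overset{\delta}{\dashrightarrow}$ and $A'\xrightarrow{x'}B'\xrightarrow{y'}C'\overset{\delta'}{\dashrightarrow}$ and morphisms $a:A\to A'$, $b:B\to B'$ with $bx=x'a$ there is $c:C\to C'$ with $cy=y'b$ and $a_*\delta=c^*\delta'$; (ET3)$^{\mathrm{op}}$ the dual; (ET4) for $\mathbb E$-triangles $A\xrightarrow{f}B\xrightarrow{f'}D\overset{\delta}{\dashrightarrow}$ and $B\xrightarrow{g}C\xrightarrow{g'}F\overset{\delta'}{\dashrightarrow}$ there are an $\mathbb E$-triangle $A\xrightarrow{gf}C\xrightarrow{h'}H\overset{\delta''}{\dashrightarrow}$ and morphisms $d:D\to H$, $e:H\to F$ with $h'g=df'$, $eh'=g'$, such that $D\xrightarrow{d}H\xrightarrow{e}F$ realizes $f'_*\delta'$, $d^*\delta''=\delta$ and $f_*\delta''=e^*\delta'$; (ET4)$^{\mathrm{op}}$ the dual. Proper classes. An $\mathbb E$-triangle is split if $\delta=0$. A class $\xi$ of $\mathbb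 E$-triangles closed under isomorphisms is a proper class if: (i) it is closed under finite coproducts and contains all split $\mathbb E$-triangles; (ii) it is closed under base change (if the $\mathbb E$-triangle realizing $\delta\in\mathbb E(C,A)$ is in $\xi$ and $c:C'\to C$, then any $\mathbb E$-triangle realizing $c^*\delta$ is in $\xi$) and cobase change (likewise for $a_*\delta$, $a:A\to A'$); (iii) it is saturated: if $A_1\to B_1\to C\overset{\delta_1}{\dashrightarrow}$ and $A_2\to B_2\xrightarrow{y_2}C\overset{\delta_2}{\dashrightarrow}$ are $\mathbb E$-triangles such that the second one and the $\mathbb E$-triangle $A_1\to M\to B_2\overset{y_2^*\delta_1}{\dashrightarrow}$ are in $\xi$, then the first one is in $\xi$. An object $P$ is $\xi$-projective if $0\to\mathcal C(P,A)\to\mathcal C(P,B)\to\mathcal C(P,C)\to0$ is exact for every $\mathbb E$-triangle $A\to B\to C\dashrightarrow$ in $\xi$; $\xi$-injective is dual. $\mathcal C$ has enough $\xi$-projectives (resp. $\xi$-injectives) if each object $A$ admits an $\mathbb E$-triangle $K\to P\to A\dashrightarrow$ (resp. $A\to I\to K\dashrightarrow$) in $\xi$ with $P$ $\xi$-projective (resp. $I$ $\xi$-injective). Standing assumptions. $(\mathcal C,\mathbb E,\mathfrak s)$ is an extriangulated category, $\xi$ is a proper class of $\mathbb E$-triangles, $\mathcal C$ has enough $\xi$-projectives and enough $\xi$-injectives, and Condition (WIC) holds: for composable $f,g$, if $gf$ is an inflation then so is $f$, and if $gf$ is a deflation then so is $g$. Closure of $\mathcal W$ under finite direct sums includes the empty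 sum, so $0\in\mathcal W$. Exactness. For a class $\mathcal W$ of objects, an $\mathbb E$-triangle $A\to B\to C\dashrightarrow$ in $\xi$ is $\mathcal C(\mathcal W,-)$-exact (resp. $\mathcal C(-,\mathcal W)$-exact) if $0\to\mathcal C(W,A)\to\mathcal C(W,B)\to\mathcal C(W,C)\to0$ (resp. $0\to\mathcal C(C,W)\to\mathcal C(B,W)\to\mathcal C(A,W)\to0$) is exact for all $W\in\mathcal W$. Gorenstein subcategory. A complete $\mathcal W(\xi)$-resolution of an object $X$ is a complex $\cdots\to W_1\to W_0\to W^0\to W^1\to\cdots$ with all terms in $\mathcal W$ which is $\xi$-exact, $\mathcal C(\mathcal W,-)$-exact and $\mathcal C(-,\mathcal W)$-exact and has $X$ as the corresponding middle term: that is, there are $\mathbb E$-triangles $X_{i+1}\to W_i\to X_i\dashrightarrow$ and $X^i\to W^i\to X^{i+1}\dashrightarrow$ ($i\ge0$) in $\xi$, each both $\mathcal C(\mathcal W,-)$-exact and $\mathcal C(-,\mathcal W)$-exact, with $X_0=X^0=X$, such that the differentials of the complex are the composites $W_{i+1}\to X_{i+1}\to W_i$, $W_0\to X\to W^0$ and $W^i\to X^{i+1}\to W^{i+1}$. Let $\mathcal{GW}(\xi)$ be the class of objects of $\mathcal C$ admitting a complete $\mathcal W(\xi)$-resolution. Put $\mathcal{GW}^1(\xi)=\mathcal{GW}(\xi)$ and, inductively for $n\ge1$, let $\mathcal{GW}^{n+1}(\xi)=\mathcal G(\mathcal{GW}^n(\xi))$ be the class obtained by the same construction with $\mathcal W$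 replaced by $\mathcal{GW}^n(\xi)$. *)

(* Defs.v *)
From HB Require Import structures.
From mathcomp Require Import all_boot all_order all_algebra.

Set Implicit Arguments.
Unset Strict Implicit.
Unset Printing Implicit Defensive.

Import GRing.Theory.

Declare Scope cat_scope.
Delimit Scope cat_scope with cat.
Reserved Notation "g ∘ f" (at level 40, left associativity).

Local Open Scope ring_scope.
Local Open Scope cat_scope.

Record preadditiveCat := PreadditiveCat {
  ob :> Type;
  hom : ob -> ob -> zmodType;
  idm : forall A, hom A A;
  cmp : forall A B D, hom B D -> hom A B -> hom A D;
  cmpA : forall A B D F (h : hom D F) (g : hom B D) (f : hom A B),
    cmp h (cmp g f) = cmp (cmp h g) f;
  cmp1m : forall A B (f : hom A B), cmp (idm B) f = f;
  cmpm1 : forall A B (f : hom A B), cmp f (idm A) = f;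
  cmpDl : forall A B D (g g' : hom B D) (f : hom A B),
    cmp (g + g') f = cmp g f + cmp g' f;
  cmpDr : forall A B D (g : hom B D) (f f' : hom A B),
    cmp g (f + f') = cmp g f + cmp g f'
}.

Notation "g ∘ f" := (cmp g f) : cat_scope.
Arguments idm {p} A.

Section Preadditive.
Variable C : preadditiveCat.

Definition is_iso (A B : C) (f : hom A B) : Prop :=
  exists g : hom B A, g ∘ f = idm A /\ f ∘ g = idm B.

Definition is_zero (Z : C) : Prop :=
  forall A : C, (forall f : hom A Z, f = 0) /\ (forall f : hom Z A, f = 0).

Record biproduct (A B : C) := Biproduct {
  bp_ob :> C;
  inj1 : hom A bp_ob;
  inj2 : hom B bp_ob;
  prj1 : hom bp_ob A;
  prj2 : hom bp_ob B;
  prj1_inj1 : prj1 ∘ inj1 = idm A;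
  prj2_inj2 : prj2 ∘ inj2 = idm B;
  prj1_inj2 : prj1 ∘ inj2 = 0;
  prj2_inj1 : prj2 ∘ inj1 = 0;
  inj_prj : inj1 ∘ prj1 + inj2 ∘ prj2 = idm bp_ob
}.

Definition dsum_hom (A B A' B' : C) (S : biproduct A A') (T : biproduct B B')
    (f : hom A B) (f' : hom A' B') : hom S T :=
  inj1 T ∘ f ∘ prj1 S + inj2 T ∘ f' ∘ prj2 S.

End Preadditive.

Record additiveCat := AdditiveCat {
  add_base :> preadditiveCat;
  has_zero : exists Z : add_base, is_zero Z;
  has_biproducts : forall A B : add_base, inhabited (biproduct A B)
}.

Record extBifunctor (C : additiveCat) := ExtBifunctor {
  ext :> C -> C -> zmodType;
  push : forall D A A', hom A A' -> {additive ext D A -> ext D A'};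
  pull : forall D D' A, hom D' D -> {additive ext D A -> ext D' A};
  push_id : forall D A (d : ext D A), push D (idm A) d = d;
  push_cmp : forall D A A' A'' (a' : hom A' A'') (a : hom A A') (d : ext D A),
    push D (a' ∘ a) d = push D a' (push D a d);
  pushD : forall D A A' (a a' : hom A A') (d : ext D A),
    push D (a + a') d = push D a d + push D a' d;
  pull_id : forall D A (d : ext D A), pull A (idm D) d = d;
  pull_cmp : forall D D' D'' A (c : hom D' D) (c' : hom D'' D') (d : ext D A),
    pull A (c ∘ c') d = pull A c' (pull A c d);
  pullD : forall D D' A (c c' : hom D' D) (d : ext D A),
    pull A (c + c') d = pull A c d + pull A c' d;
  push_pull : forall D D' A A' (a : hom A A') (c : hom D' D) (d : ext D A),
    push D' a (pull A c d) = pull A' c (push D a d)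
}.

Arguments push {C e D A A'} a.
Arguments pull {C e D D' A} c.

Section Extriangulated.
Variables (C : additiveCat) (E : extBifunctor C).

(* The element of E(D (+) D', A (+) A') corresponding to (d, 0, 0, d') under
   its decomposition as E(D, A) (+) E(D, A') (+) E(D', A) (+) E(D', A'). *)
Definition dsum_ext (A D A' D' : C) (SA : biproduct A A') (SD : biproduct D D')
    (d : E D A) (d' : E D' A') : E SD SA :=
  push (inj1 SA) (pull (prj1 SD) d) + push (inj2 SA) (pull (prj2 SD) d').

(* A sequence A -> B -> D together with an element of E(D, A); whether the
   sequence realizes the element is a separate matter. *)
Record triple := Triple {
  t_src : C;
  t_mid : C;
  t_tgt : C;
  t_inf : hom t_src t_mid;
  t_def : hom t_mid t_tgt;
  t_ext : E t_tgt t_src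
}.

Definition equivalent_seq (A B B' D : C) (x : hom A B) (y : hom B D)
    (x' : hom A B') (y' : hom B' D) : Prop :=
  exists b : hom B B', [/\ is_iso b, b ∘ x = x' & y' ∘ b = y].

(* The assignment d |-> s(d) is encoded by the class of triples (x, y, d) such
   that s(d) = [x, y]; these are the E-triangles.  The first two fields below
   say that the sequences x, y with s (Triple x y d) form one equivalence
   class. *)
Definition triple_class := triple -> Prop.
Implicit Types (s xi : triple_class) (T : triple).

Record is_realization s : Prop := IsRealization {
  rlz_ex : forall (A D : C) (d : E D A),
    exists (B : C) (x : hom A B) (y : hom B D), s (Triple x y d);
  rlz_class : forall (A B B' D : C) (d : E D A) (x : hom A B) (y : hom B D)
      (x' : hom A B') (y' : hom B' D),
    s (Triple x y d) -> (s (Triple x' y' d) <-> equivalent_seq x y x' y');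
  rlz_mor : forall (A B D A' B' D' : C) (x : hom A B) (y : hom B D) (d : E D A)
      (x' : hom A' B') (y' : hom B' D') (d' : E D' A')
      (a : hom A A') (c : hom D D'),
    s (Triple x y d) -> s (Triple x' y' d') -> push a d = pull c d' ->
    exists b : hom B B', b ∘ x = x' ∘ a /\ y' ∘ b = c ∘ y
}.

Record is_additive_realization s : Prop := IsAdditiveRealization {
  arlz_rlz : is_realization s;
  arlz_zero : forall (A D : C) (S : biproduct A D),
    s (Triple (inj1 S) (prj2 S) 0);
  arlz_dsum : forall (A B D A' B' D' : C) (x : hom A B) (y : hom B D)
      (d : E D A) (x' : hom A' B') (y' : hom B' D') (d' : E D' A')
      (SA : biproduct A A') (SB : biproduct B B') (SD : biproduct D D'),
    s (Triple x y d) -> s (Triple x' y' d') ->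
    s (Triple (dsum_hom SA SB x x') (dsum_hom SB SD y y') (dsum_ext SA SD d d'))
}.

Definition ET3 s : Prop :=
  forall (A B D A' B' D' : C) (x : hom A B) (y : hom B D) (d : E D A)
    (x' : hom A' B') (y' : hom B' D') (d' : E D' A')
    (a : hom A A') (b : hom B B'),
  s (Triple x y d) -> s (Triple x' y' d') -> b ∘ x = x' ∘ a ->
  exists c : hom D D', c ∘ y = y' ∘ b /\ push a d = pull c d'.

Definition ET3op s : Prop :=
  forall (A B D A' B' D' : C) (x : hom A B) (y : hom B D) (d : E D A)
    (x' : hom A' B') (y' : hom B' D') (d' : E D' A')
    (b : hom B B') (c : hom D D'),
  s (Triple x y d) -> s (Triple x' y' d') -> c ∘ y = y' ∘ b ->
  exists a : hom A A', b ∘ x = x' ∘ a /\ push a d = pull c d'.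

Definition ET4 s : Prop :=
  forall (A B D K F : C) (f : hom A B) (f' : hom B D) (d : E D A)
    (g : hom B K) (g' : hom K F) (d' : E F B),
  s (Triple f f' d) -> s (Triple g g' d') ->
  exists (H : C) (h' : hom K H) (d'' : E H A) (u : hom D H) (v : hom H F),
    [/\ s (Triple (g ∘ f) h' d''),
        h' ∘ g = u ∘ f' /\ v ∘ h' = g',
        s (Triple u v (push f' d')),
        pull u d'' = d
      & push f d'' = pull v d'].

Definition ET4op s : Prop :=
  forall (A B D K F : C) (f : hom B A) (f' : hom D B) (d : E A D)
    (g : hom K B) (g' : hom F K) (d' : E B F),
  s (Triple f' f d) -> s (Triple g' g d') ->
  exists (H : C) (h' : hom H K) (d'' : E A H) (u : hom H D) (v : hom F H),
    [/\ s (Triple h' (f ∘ g) d''),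
        g ∘ h' = f' ∘ u /\ h' ∘ v = g',
        s (Triple v u (pull f' d')),
        push u d'' = d
      & pull f d'' = push v d'].

Record extriangulated s : Prop := Extriangulated {
  etr_rlz : is_additive_realization s;
  etr_ET3 : ET3 s;
  etr_ET3op : ET3op s;
  etr_ET4 : ET4 s;
  etr_ET4op : ET4op s
}.

Definition inflation s (A B : C) (x : hom A B) : Prop :=
  exists (D : C) (y : hom B D) (d : E D A), s (Triple x y d).

Definition deflation s (B D : C) (y : hom B D) : Prop :=
  exists (A : C) (x : hom A B) (d : E D A), s (Triple x y d).

Definition WIC s : Prop :=
  forall (A B D : C) (f : hom A B) (g : hom B D),
    (inflation s (g ∘ f) -> inflation s f) /\
    (deflation s (g ∘ f) -> deflation s g).

Definition iso_triple T T' : Prop :=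
  exists (a : hom (t_src T) (t_src T')) (b : hom (t_mid T) (t_mid T'))
    (c : hom (t_tgt T) (t_tgt T')),
  [/\ is_iso a /\ is_iso b /\ is_iso c,
      b ∘ t_inf T = t_inf T' ∘ a,
      c ∘ t_def T = t_def T' ∘ b
    & push a (t_ext T) = pull c (t_ext T')].

(* The empty coproduct 0 -> 0 -> 0 is covered by pc_split. *)
Record proper_class s xi : Prop := ProperClass {
  pc_sub : forall T, xi T -> s T;
  pc_iso : forall T T', s T' -> iso_triple T T' -> xi T -> xi T';
  pc_coprod : forall (A B D A' B' D' : C) (x : hom A B) (y : hom B D)
      (d : E D A) (x' : hom A' B') (y' : hom B' D') (d' : E D' A')
      (SA : biproduct A A') (SB : biproduct B B') (SD : biproduct D D'),
    xi (Triple x y d) -> xi (Triple x' y' d') ->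
    xi (Triple (dsum_hom SA SB x x') (dsum_hom SB SD y y')
               (dsum_ext SA SD d d'));
  pc_split : forall T, s T -> t_ext T = 0 -> xi T;
  pc_base : forall (A B D D' M : C) (x : hom A B) (y : hom B D) (d : E D A)
      (c : hom D' D) (m : hom A M) (n : hom M D'),
    xi (Triple x y d) -> s (Triple m n (pull c d)) -> xi (Triple m n (pull c d));
  pc_cobase : forall (A A' B D M : C) (x : hom A B) (y : hom B D) (d : E D A)
      (a : hom A A') (m : hom A' M) (n : hom M D),
    xi (Triple x y d) -> s (Triple m n (push a d)) -> xi (Triple m n (push a d));
  pc_saturated : forall (A1 B1 A2 B2 M D : C)
      (x1 : hom A1 B1) (y1 : hom B1 D) (d1 : E D A1)
      (x2 : hom A2 B2) (y2 : hom B2 D) (d2 : E D A2)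
      (m : hom A1 M) (n : hom M B2),
    s (Triple x1 y1 d1) -> xi (Triple x2 y2 d2) ->
    xi (Triple m n (pull y2 d1)) -> xi (Triple x1 y1 d1)
}.

(* Exactness of 0 -> U -> V -> Z -> 0. *)
Definition short_exact (U V Z : zmodType) (f : U -> V) (g : V -> Z) : Prop :=
  [/\ injective f,
      forall v : V, g v = 0 <-> exists u : U, f u = v
    & forall z : Z, exists v : V, g v = z].

Definition hom_exact (P : C) T : Prop :=
  short_exact (fun f : hom P (t_src T) => t_inf T ∘ f)
              (fun f : hom P (t_mid T) => t_def T ∘ f).

Definition cohom_exact (Q : C) T : Prop :=
  short_exact (fun f : hom (t_tgt T) Q => f ∘ t_def T)
              (fun f : hom (t_mid T) Q => f ∘ t_inf T).

Definition xi_projective xi (P : C) : Prop := forall T, xi T -> hom_exact P T.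
Definition xi_injective xi (I : C) : Prop := forall T, xi T -> cohom_exact I T.

Definition enough_projectives xi : Prop :=
  forall A : C, exists (K P : C) (x : hom K P) (y : hom P A) (d : E A K),
    xi (Triple x y d) /\ xi_projective xi P.

Definition enough_injectives xi : Prop :=
  forall A : C, exists (I K : C) (x : hom A I) (y : hom I K) (d : E K A),
    xi (Triple x y d) /\ xi_injective xi I.

Implicit Type W : C -> Prop.

Definition closed_iso W : Prop :=
  forall (A B : C) (f : hom A B), is_iso f -> W A -> W B.

Definition closed_dsum W : Prop :=
  (forall Z : C, is_zero Z -> W Z) /\
  (forall (A B : C) (S : biproduct A B), W A -> W B -> W S).

Definition closed_summand W : Prop :=
  forall (A B : C) (S : biproduct A B), W S -> W A /\ W B.

Definition exact_for xi W T : Prop :=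
  [/\ xi T,
      forall P : C, W P -> hom_exact P T
    & forall Q : C, W Q -> cohom_exact Q T].

(* ... -> W_1 -> W_0 -> W^0 -> W^1 -> ..., with W_i = cx_lo i, W^i = cx_up i. *)
Record complex := Complex {
  cx_lo : nat -> C;
  cx_up : nat -> C;
  dlo : forall i, hom (cx_lo i.+1) (cx_lo i);
  dmid : hom (cx_lo 0) (cx_up 0);
  dup : forall i, hom (cx_up i) (cx_up i.+1);
  dlo_dlo : forall i, dlo i ∘ dlo i.+1 = 0;
  dmid_dlo : dmid ∘ dlo 0 = 0;
  dup_dmid : dup 0 ∘ dmid = 0;
  dup_dup : forall i, dup i.+1 ∘ dup i = 0
}.

(* X_0 = X and X_(i+1) = Y i. *)
Definition from0 (X : C) (Y : nat -> C) (i : nat) : C :=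
  if i is j.+1 then Y j else X.

(* With X_i = from0 X cr_lo i and X^i = from0 X cr_up i, so that X_0 and X^0
   are both definitionally X, the E-triangles are
     X_(i+1) -> W_i -> X_i   and   X^i -> W^i -> X^(i+1). *)
Record complete_resolution xi W (X : C) := CompleteResolution {
  cr_cx :> complex;
  cr_Wlo : forall i, W (cx_lo cr_cx i);
  cr_Wup : forall i, W (cx_up cr_cx i);
  cr_lo : nat -> C;
  cr_up : nat -> C;
  xlo : forall i, hom (from0 X cr_lo i.+1) (cx_lo cr_cx i);
  ylo : forall i, hom (cx_lo cr_cx i) (from0 X cr_lo i);
  elo : forall i, E (from0 X cr_lo i) (from0 X cr_lo i.+1);
  xup : forall i, hom (from0 X cr_up i) (cx_up cr_cx i);
  yup : forall i, hom (cx_up cr_cx i) (from0 X cr_up i.+1);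
  eup : forall i, E (from0 X cr_up i.+1) (from0 X cr_up i);
  cr_exact_lo : forall i, exact_for xi W (Triple (xlo i) (ylo i) (elo i));
  cr_exact_up : forall i, exact_for xi W (Triple (xup i) (yup i) (eup i));
  cr_dlo : forall i, dlo cr_cx i = xlo i ∘ ylo i.+1;
  cr_dmid : dmid cr_cx = xup 0 ∘ (ylo 0 : hom _ X);
  cr_dup : forall i, dup cr_cx i = xup i.+1 ∘ yup i
}.

Definition GW xi W (X : C) : Prop := inhabited (complete_resolution xi W X).

(* GW_iter xi W n is GW^n(xi) for n >= 1; for n = 0 it is W. *)
Definition GW_iter xi W (n : nat) : C -> Prop := iter n (GW xi) W.

End Extriangulated.

(* Main.v *)
Require Import Defs.
From mathcomp Require Import all_boot all_order all_algebra.
From Stdlib Require Import IndefiniteDescription.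
Import Defs.

(** Belonging to GW(xi) is a conjunction of two conditions that are exchanged
    by passing to the opposite category: X is the right end of an infinite
    W-exact xi-exact resolution by objects of W, and the left end of a
    coresolution ([GW_left_right]).  So only the left condition,
    [left_resolved], has to be studied.

    Everything follows from one stability property ([left_resolved_closed]):
    if every member X of a class U has a W-exact triangle X' -> G -> X in xi
    with X' in U and G left resolved, then every member of U is left resolved.
    To see this, let K consist of all iterated W-exact extensions of members of
    U and of left resolved objects, and check that every Z in K has a W-exact
    triangle Z' -> W0 -> Z with W0 in W and Z' again in K:
    - for X in U, cover G by some W0 in W, with kernel G'; the composite
      W0 -> G -> X is a deflation whose kernel is an extension of X' by G'
      ([exact_for_comp], which rests on (ET4)op and on saturation);
    - for an extension, combine coverings of both ends into a covering of the
      middle by the horseshoe construction ([exact_for_horseshoe]); its kernel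
      is an extension of the two kernels.
    A left resolved Z has such a triangle by definition.

    With U the terms of a resolution by objects of GW(xi), this gives
    G(GW(xi)) = GW(xi), hence (1) by induction.  With U the direct summands of
    left resolved objects, and the split triangles B -> A + B -> A, it gives
    (2).

    The opposite of (C, E, s) is again extriangulated, but saturation is not
    visibly self-dual; its dual is deduced from the existence of enough
    xi-injectives ([cosaturated]). *)

Set Implicit Arguments.
Unset Strict Implicit.
Unset Printing Implicit Defensive.
Import GRing.Theory.
Local Open Scope ring_scope.
Local Open Scope cat_scope.

(** * Preadditive categories *)
Section Preadditive.
Variable C : preadditiveCat.

Lemma cmp0m (A B D : C) (f : hom A B) : (0 : hom B D) ∘ f = 0.
Proof. by apply: (addrI (0 ∘ f)); rewrite -cmpDl !addr0. Qed.

Lemma cmpm0 (A B D : C) (g : hom B D) : g ∘ (0 : hom A B) = 0.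
Proof. by apply: (addrI (g ∘ 0)); rewrite -cmpDr !addr0. Qed.

Lemma cmpNm (A B D : C) (g : hom B D) (f : hom A B) : (- g) ∘ f = - (g ∘ f).
Proof. by apply: (addrI (g ∘ f)); rewrite -cmpDl !subrr cmp0m. Qed.

Lemma cmpmN (A B D : C) (g : hom B D) (f : hom A B) : g ∘ (- f) = - (g ∘ f).
Proof. by apply: (addrI (g ∘ f)); rewrite -cmpDr !subrr cmpm0. Qed.

Definition swap_biproduct (A B : C) (S : biproduct A B) : biproduct B A :=
  Biproduct (prj2_inj2 S) (prj1_inj1 S) (prj2_inj1 S) (prj1_inj2 S)
    (etrans (addrC _ _) (inj_prj S)).

Definition zero_biproduct (Z A : C) (Z0 : is_zero Z) : biproduct A Z.
Proof.
refine (@Biproduct C A Z A (idm A) 0 (idm A) 0 _ _ _ _ _).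
- exact: cmp1m.
- by rewrite cmpm0 ((Z0 Z).1 (idm Z)).
- exact: cmpm0.
- exact: cmp0m.
- by rewrite cmp1m cmpm0 addr0.
Defined.

End Preadditive.

(** * The opposite category *)
Section OppositePreadditive.
Variable C : preadditiveCat.

Definition op_pre : preadditiveCat.
Proof.
refine (@PreadditiveCat (ob C) (fun A B => @hom C B A) (fun A => idm A)
  (fun A B D g f => f ∘ g) _ _ _ _ _).
- by move=> *; rewrite cmpA.
- by move=> *; apply: cmpm1.
- by move=> *; apply: cmp1m.
- by move=> *; apply: cmpDr.
- by move=> *; apply: cmpDl.
Defined.

Definition op_biproduct (A B : C) (S : biproduct A B) :
    @biproduct op_pre A B :=
  @Biproduct op_pre A B S (prj1 S) (prj2 S) (inj1 S) (inj2 S)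
    (prj1_inj1 S) (prj2_inj2 S) (prj2_inj1 S) (prj1_inj2 S) (inj_prj S).

Definition unop_biproduct (A B : C) (S : @biproduct op_pre A B) :
    biproduct A B :=
  @Biproduct C A B (bp_ob S) (prj1 S) (prj2 S) (inj1 S) (inj2 S)
    (prj1_inj1 S) (prj2_inj2 S) (prj2_inj1 S) (prj1_inj2 S) (inj_prj S).

Lemma op_is_zero (Z : C) : @is_zero op_pre Z <-> is_zero Z.
Proof. by split=> hZ A; have [h1 h2] := hZ A. Qed.

Lemma op_is_iso (A B : C) (f : hom B A) : @is_iso op_pre A B f <-> is_iso f.
Proof. by split=> -[g [h1 h2]]; exists g. Qed.

Lemma op_dsum_hom (A B A' B' : C) (S : @biproduct op_pre A A')
    (T : @biproduct op_pre B B') (f : hom B A) (f' : hom B' A') :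
  @dsum_hom op_pre A B A' B' S T f f'
    = dsum_hom (unop_biproduct T) (unop_biproduct S) f f'.
Proof. by rewrite /dsum_hom /= !cmpA. Qed.

End OppositePreadditive.

Definition op_cat (C : additiveCat) : additiveCat.
Proof.
refine (@AdditiveCat (op_pre C) _ _).
- by have [Z hZ] := has_zero C; exists Z; apply/op_is_zero.
- by move=> A B; have [S] := has_biproducts A B; exists; apply: op_biproduct.
Defined.

Lemma equivalent_seq_sym (C : additiveCat) (A B B' D : C) (x : hom A B) (y : hom B D)
    (x' : hom A B') (y' : hom B' D) :
  equivalent_seq x y x' y' -> equivalent_seq x' y' x y.
Proof.
move=> [b [[c [cb bc]] <- <-]]; exists c; split; first by exists b.
- by rewrite cmpA cb cmp1m.
- by rewrite -cmpA bc cmpm1.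
Qed.

Lemma op_equivalent_seq (C : additiveCat) (A B B' D : C) (x : hom A B) (y : hom B D)
    (x' : hom A B') (y' : hom B' D) :
  @equivalent_seq (op_cat C) D B B' A y x y' x' <-> equivalent_seq x y x' y'.
Proof.
split=> [[b [bi b1 b2]]|/equivalent_seq_sym[b [bi b1 b2]]].
  by apply: equivalent_seq_sym; exists b; split=> //; apply/op_is_iso.
by exists b; split=> //; apply/op_is_iso.
Qed.

Section OppositeExt.
Variables (C : additiveCat) (E : extBifunctor C).

Definition op_ext : extBifunctor (op_cat C).
Proof.
refine (@ExtBifunctor (op_cat C) (fun D A => E A D)
  (fun D A A' a => @pull C E A A' D a) (fun D D' A c => @push C E A D D' c)
  _ _ _ _ _ _ _).
- by move=> *; apply: pull_id.
- by move=> *; apply: pull_cmp.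
- by move=> *; apply: pullD.
- by move=> *; apply: push_id.
- by move=> *; apply: push_cmp.
- by move=> *; apply: pushD.
- by move=> *; apply/esym; apply: push_pull.
Defined.

Definition unop_triple (T : triple op_ext) : triple E :=
  @Triple C E _ _ _ (t_def T) (t_inf T) (t_ext T).

Definition op_class (s : triple_class E) : triple_class op_ext :=
  fun T => s (unop_triple T).

Lemma op_dsum_ext (A D A' D' : C) (SA : @biproduct (op_cat C) A A')
    (SD : @biproduct (op_cat C) D D') (d : E A D) (d' : E A' D') :
  @dsum_ext (op_cat C) op_ext A D A' D' SA SD d d' =
  dsum_ext (unop_biproduct SD) (unop_biproduct SA) d d'.
Proof. by rewrite /dsum_ext /= !push_pull. Qed.

Variable s : triple_class E.

(** The axioms come in dual pairs, (ET3) with (ET3)op and (ET4) with (ET4)op,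
    and the axioms of an additive realization are self-dual because equivalence
    of sequences is symmetric. *)
Lemma op_extriangulated : extriangulated s -> extriangulated (op_class s).
Proof.
case=> -[[hex hcl hmor] h0 hds] h3 h3' h4 h4'.
split; first split; first split.
- move=> A D d; have [B [x [y sT]]] := hex _ _ (d : E A D).
  by exists B, y, x.
- move=> A B B' D d x y x' y' sT; split.
    by move=> sT'; apply/op_equivalent_seq/(hcl _ _ _ _ _ _ _ _ _ sT).
  by move=> /op_equivalent_seq /(hcl _ _ _ _ _ _ _ _ _ sT).
- move=> A B D A' B' D' x y d x' y' d' a c sT sT' e.
  have [b [b1 b2]] := hmor _ _ _ _ _ _ _ _ _ _ _ _ c a sT' sT (esym e).
  by exists b.
- by move=> A D S; apply: (h0 _ _ (swap_biproduct (unop_biproduct S))).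
- move=> A B D A' B' D' x y d x' y' d' SA SB SD sT sT'.
  rewrite /op_class /unop_triple /=.
  rewrite op_dsum_ext !op_dsum_hom.
  exact: (hds _ _ _ _ _ _ _ _ _ _ _ _ (unop_biproduct SD) (unop_biproduct SB)
    (unop_biproduct SA) sT sT').
- move=> A B D A' B' D' x y d x' y' d' a b sT sT' e.
  have [c [c1 c2]] := h3' _ _ _ _ _ _ _ _ _ _ _ _ b a sT' sT (esym e).
  by exists c.
- move=> A B D A' B' D' x y d x' y' d' b c sT sT' e.
  have [a [a1 a2]] := h3 _ _ _ _ _ _ _ _ _ _ _ _ c b sT' sT (esym e).
  by exists a.
- move=> A B D K F f f' d g g' d' sT sT'.
  exact: (h4' _ _ _ _ _ _ _ _ _ _ _ sT sT').
- move=> A B D K F f f' d g g' d' sT sT'.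
  exact: (h4 _ _ _ _ _ _ _ _ _ _ _ sT sT').
Qed.

End OppositeExt.

(** * Exact sequences and pullbacks of triangles *)
Section Triangles.
Variables (C : additiveCat) (E : extBifunctor C) (s : triple_class E).
Hypothesis hs : extriangulated s.

Let arlz := etr_rlz hs.
Let rlz := arlz_rlz arlz.

Lemma triangle_id_zero (A Z : C) : is_zero Z -> s (Triple (idm A) (0 : hom A Z) 0).
Proof. by move=> Z0; apply: (arlz_zero arlz (zero_biproduct A Z0)). Qed.

Lemma triangle_zero_id (A Z : C) : is_zero Z -> s (Triple (0 : hom Z A) (idm A) 0).
Proof.
by move=> Z0; apply: (arlz_zero arlz (swap_biproduct (zero_biproduct A Z0))).
Qed.

(** The two long exact sequences attached to a triangle, obtained by comparing
    it, through (ET3), (ET3)op or the realization of morphisms, with the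
    triangles P = P -> 0, 0 -> Q = Q and the split ones. *)
Section OneTriangle.
Variables (A B D : C) (x : hom A B) (y : hom B D) (d : E D A).
Hypothesis sT : s (Triple x y d).

Lemma def_inf0 : y ∘ x = 0.
Proof.
have [Z Z0] := has_zero C.
have [|c [<- _]] := etr_ET3 hs (a := idm A) (b := x) (triangle_id_zero A Z0) sT.
  by [].
exact: cmpm0.
Qed.

Lemma push_inf0 : push x d = 0.
Proof.
have [Z Z0] := has_zero C.
have [|c [_ ->]] := etr_ET3 hs (a := x) (b := idm B) sT (triangle_id_zero B Z0).
  by [].
exact: raddf0.
Qed.

Lemma pull_def0 : pull y d = 0.
Proof.
have [Z Z0] := has_zero C.
have [|a [_ <-]] := etr_ET3op hs (b := idm B) (c := y) (triangle_zero_id B Z0) sT.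
  by [].
exact: raddf0.
Qed.

Lemma lift_inf (P : C) (f : hom P B) : y ∘ f = 0 -> exists t, f = x ∘ t.
Proof.
move=> yf; have [Z Z0] := has_zero C.
have [|a [e _]] := etr_ET3op hs (b := f) (c := 0) (triangle_id_zero P Z0) sT.
  by rewrite cmpm0.
by exists a; rewrite -e cmpm1.
Qed.

Lemma factor_def (Q : C) (f : hom B Q) : f ∘ x = 0 -> exists t, f = t ∘ y.
Proof.
move=> fx; have [Z Z0] := has_zero C.
have [|c [e _]] := etr_ET3 hs (a := 0) (b := f) sT (triangle_zero_id Q Z0).
  by rewrite cmpm0.
by exists c; rewrite e cmp1m.
Qed.

Lemma lift_def (P : C) (c : hom P D) : pull c d = 0 -> exists f, y ∘ f = c.
Proof.
move=> cd; have [S] := has_biproducts A P.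
have [|b [_ e]] := rlz_mor rlz (a := idm A) (c := c) (arlz_zero arlz S) sT.
  by rewrite raddf0 cd.
by exists (b ∘ inj2 S); rewrite cmpA e -cmpA prj2_inj2 cmpm1.
Qed.

Lemma extend_inf (Q : C) (a : hom A Q) : push a d = 0 -> exists f, f ∘ x = a.
Proof.
move=> ad; have [S] := has_biproducts Q D.
have [|b [e _]] := rlz_mor rlz (a := a) (c := idm D) sT (arlz_zero arlz S).
  by rewrite raddf0 ad.
by exists (prj1 S ∘ b); rewrite -cmpA e cmpA prj1_inj1 cmp1m.
Qed.

(** Exactness of Hom(D, K) -> E(D, A) -> E(D, I) at E(D, A). *)
Lemma pull_of_push_eq0 (I K : C) (i : hom A I) (p : hom I K) (e : E K A) :
  s (Triple i p e) -> push i d = 0 -> exists c, d = pull c e.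
Proof.
move=> sI /extend_inf[b bx].
have [|c [_ dc]] := etr_ET3 hs (a := idm A) (b := b) sT sI.
  by rewrite cmpm1.
by exists c; rewrite -dc push_id.
Qed.

End OneTriangle.

(** Compare with a realization of [pull u e].  The comparison of the middle
    terms has a right inverse and a left inverse by the four lemma in each of
    the two long exact sequences, hence is an isomorphism. *)
Lemma triangle_iso_tgt (A M D D' : C) (x : hom A M) (y : hom M D) (e : E D A)
    (u : hom D' D) (v : hom D D') :
  u ∘ v = idm D -> v ∘ u = idm D' ->
  s (Triple x y e) -> s (Triple x (v ∘ y) (pull u e)).
Proof.
move=> uv vu sT; have [M' [x' [y' sT']]] := rlz_ex rlz (pull u e).
have [|b [b1 b2]] := rlz_mor rlz (a := idm A) (c := u) sT' sT.
  by rewrite push_id.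
rewrite cmpm1 in b1.
have [r br] : exists r, b ∘ r = idm M.
  have [|g g1] := lift_def sT' (c := v ∘ y).
    by rewrite -pull_cmp cmpA uv cmp1m (pull_def0 sT).
  have [|t ht] := lift_inf sT (f := b ∘ g - idm M).
    by rewrite cmpDr cmpmN cmpm1 cmpA b2 -cmpA g1 cmpA uv cmp1m subrr.
  exists (g - x' ∘ t); rewrite cmpDr cmpmN cmpA b1 -ht opprB addrCA.
  by rewrite subrr addr0.
have [l lb] : exists l, l ∘ b = idm M'.
  have [|h h1] := extend_inf sT (a := x').
    rewrite -[push x' e]pull_id -uv pull_cmp -push_pull.
    by rewrite (push_inf0 sT') raddf0.
  have [|t ht] := factor_def sT' (f := h ∘ b - idm M').
    by rewrite cmpDl cmpNm cmp1m -cmpA b1 h1 subrr.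
  exists (h - t ∘ v ∘ y); rewrite cmpDl cmpNm -!cmpA b2 [v ∘ _]cmpA vu cmp1m -ht.
  by rewrite opprB addrCA subrr addr0.
have lr : l = r by rewrite -[l]cmpm1 -br cmpA lb cmp1m.
apply/(rlz_class rlz _ _ sT'); exists b; split=> //.
  by exists r; split=> //; rewrite -lr.
by rewrite -cmpA b2 cmpA vu cmp1m.
Qed.

(** One half of [triangle_pullback]: M realizes an element of E(B, A1 + A2), and
    (ET4) applied to the composite A1 -> A1 + A2 -> M identifies the cokernel of
    A1 -> M with the realization Z of the component in E(B, A2). *)
Lemma triangle_pullback_inj1 (A1 A2 B M Z : C) (S : biproduct A1 A2)
    (g : hom S M) (g' : hom M B) (m : E B S) (x2 : hom A2 Z) (y2 : hom Z B) :
  s (Triple g g' m) -> s (Triple x2 y2 (push (prj2 S) m)) ->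
  exists n : hom M Z, [/\ n ∘ g = x2 ∘ prj2 S, y2 ∘ n = g'
    & s (Triple (g ∘ inj1 S) n (pull y2 (push (prj1 S) m)))].
Proof.
move=> sM s2.
have [H [h' [d [u [v [sd [hg vh] suv _ fd]]]]]] :=
  etr_ET4 hs (arlz_zero arlz S) sM.
have [b [[b' [bb b'b]] bu vb]] := (rlz_class rlz _ _ suv).1 s2.
exists (b ∘ h'); split.
- by rewrite -cmpA hg cmpA bu.
- by rewrite cmpA vb vh.
have := triangle_iso_tgt bb b'b sd.
suff -> : pull b' d = pull y2 (push (prj1 S) m) by [].
have -> : d = pull v (push (prj1 S) m).
  by rewrite -push_pull -fd -push_cmp prj1_inj1 push_id.
by rewrite -pull_cmp -vb -cmpA b'b cmpm1.
Qed.

(** The pullback of two deflations y1, y2 with the same target: M realizes the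
    element of E(D, A1 + A2) with components d1 and d2. *)
Lemma triangle_pullback (A1 B1 A2 B2 D : C)
    (x1 : hom A1 B1) (y1 : hom B1 D) (d1 : E D A1)
    (x2 : hom A2 B2) (y2 : hom B2 D) (d2 : E D A2) :
  s (Triple x1 y1 d1) -> s (Triple x2 y2 d2) ->
  exists (M : C) (m1 : hom A1 M) (m2 : hom A2 M) (n1 : hom M B1) (n2 : hom M B2),
  [/\ s (Triple m1 n2 (pull y2 d1)), s (Triple m2 n1 (pull y1 d2)),
      n1 ∘ m1 = x1, n2 ∘ m2 = x2 & y1 ∘ n1 = y2 ∘ n2].
Proof.
move=> s1 s2; have [S] := has_biproducts A1 A2.
pose m : E D S := push (inj1 S) d1 + push (inj2 S) d2.
have p1m : push (prj1 S) m = d1.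
  rewrite raddfD /= -!push_cmp prj1_inj1 prj1_inj2 push_id.
  suff -> : push (0 : hom A2 A1) d2 = 0 by rewrite addr0.
  by apply: (addrI (push 0 d2)); rewrite -pushD !addr0.
have p2m : push (prj2 S) m = d2.
  rewrite raddfD /= -!push_cmp prj2_inj2 prj2_inj1 push_id.
  suff -> : push (0 : hom A1 A2) d1 = 0 by rewrite add0r.
  by apply: (addrI (push 0 d1)); rewrite -pushD !addr0.
have [M [g [g' sM]]] := rlz_ex rlz m.
have [|n2 [n2g yn2 t2]] := triangle_pullback_inj1 (x2 := x2) (y2 := y2) sM.
  by rewrite p2m.
have [|n1 [n1g yn1 t1]] :=
    triangle_pullback_inj1 (S := swap_biproduct S) (x2 := x1) (y2 := y1) sM.
  by rewrite p1m.
rewrite /= in n1g t1.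
exists M, (g ∘ inj1 S), (g ∘ inj2 S), n1, n2; split.
- by move: t2; rewrite p1m.
- by move: t1; rewrite p2m.
- by rewrite cmpA n1g -cmpA prj1_inj1 cmpm1.
- by rewrite cmpA n2g -cmpA prj2_inj2 cmpm1.
- by rewrite yn1 yn2.
Qed.

(** If y2 lifts through y1, the first triangle splits over B2, so the pullback
    of y1 and y2 may be taken to be the given biproduct A1 + B2. *)
Lemma triangle_pullback_split (A1 B1 A2 B2 D : C)
    (x1 : hom A1 B1) (y1 : hom B1 D) (d1 : E D A1)
    (x2 : hom A2 B2) (y2 : hom B2 D) (d2 : E D A2) (S : biproduct A1 B2) :
  s (Triple x1 y1 d1) -> s (Triple x2 y2 d2) -> pull y2 d1 = 0 ->
  exists (m : hom A2 S) (n : hom S B1),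
  [/\ s (Triple m n (pull y1 d2)),
      n ∘ inj1 S = x1, prj2 S ∘ m = x2 & y1 ∘ n = y2 ∘ prj2 S].
Proof.
move=> s1 s2 d0.
have [M [m1 [m2 [n1 [n2 [sm1 sm2 e1 e2 e]]]]]] := triangle_pullback s1 s2.
rewrite d0 in sm1.
have [b [[b' [b'b bb']] bm pb]] := (rlz_class rlz _ _ sm1).1 (arlz_zero arlz S).
exists (b ∘ m2), (n1 ∘ b'); split.
- apply/(rlz_class rlz _ _ sm2); exists b; split=> //; first by exists b'.
  by rewrite -cmpA b'b cmpm1.
- by rewrite -bm -cmpA [b' ∘ _]cmpA b'b cmp1m.
- by rewrite cmpA pb.
- by rewrite cmpA e -pb -2!cmpA bb' cmpm1.
Qed.

End Triangles.

(** * Triangles exact relative to a class of objects *)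
Section Exactness.
Variables (C : additiveCat) (E : extBifunctor C) (s : triple_class E).
Hypothesis hs : extriangulated s.

(** Exactness in the middle is automatic, and every map P -> D lifts through y
    if and only if it kills d; what remains is injectivity on the left. *)
Lemma hom_exactP (P A B D : C) (x : hom A B) (y : hom B D) (d : E D A) :
  s (Triple x y d) ->
  hom_exact P (Triple x y d) <->
  (forall t : hom P A, x ∘ t = 0 -> t = 0) /\ (forall c, pull (c : hom P D) d = 0).
Proof.
move=> sT; rewrite /hom_exact /=; split=> [[xI _ yS]|[xI d0]]; split.
- by move=> t xt; apply: xI; rewrite xt cmpm0.
- move=> c; have [v <-] := yS c.
  by rewrite pull_cmp (pull_def0 hs sT) raddf0.
- move=> t t' e; apply/subr0_eq/xI.
  by rewrite cmpDr cmpmN e subrr.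
- move=> v; split=> [/(lift_inf hs sT)[t ->]|[t <-]]; first by exists t.
  by rewrite cmpA (def_inf0 hs sT) cmp0m.
- by move=> c; apply: (lift_def hs sT).
Qed.

End Exactness.

Lemma cohom_exactP (C : additiveCat) (E : extBifunctor C) (s : triple_class E)
    (hs : extriangulated s) (Q A B D : C)
    (x : hom A B) (y : hom B D) (d : E D A) :
  s (Triple x y d) ->
  cohom_exact Q (Triple x y d) <->
  (forall t : hom D Q, t ∘ y = 0 -> t = 0) /\ (forall a, push (a : hom A Q) d = 0).
Proof.
move=> sT.
exact: (@hom_exactP (op_cat C) (op_ext E) (op_class s) (op_extriangulated hs)
  Q D B A y x d sT).
Qed.

Section Resolutions.
Variables (C : additiveCat) (E : extBifunctor C) (s xi : triple_class E).
Hypotheses (hs : extriangulated s) (hxi : proper_class s xi).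
Variable W : C -> Prop.

Let arlz := etr_rlz hs.
Let rlz := arlz_rlz arlz.

Lemma exact_forP (A B D : C) (x : hom A B) (y : hom B D) (d : E D A) :
  exact_for xi W (Triple x y d) <->
  [/\ xi (Triple x y d),
    forall P, W P -> (forall t : hom P A, x ∘ t = 0 -> t = 0) /\
      (forall c, pull (c : hom P D) d = 0)
  & forall Q, W Q -> (forall t : hom D Q, t ∘ y = 0 -> t = 0) /\
      (forall a, push (a : hom A Q) d = 0)].
Proof.
split=> -[xT hP hQ]; have sT := pc_sub hxi xT; split=> //.
- by move=> P /hP /(hom_exactP hs P sT).
- by move=> Q /hQ /(cohom_exactP hs Q sT).
- by move=> P /hP /(hom_exactP hs P sT).
- by move=> Q /hQ /(cohom_exactP hs Q sT).
Qed.

Lemma exact_for_split (A D : C) (S : biproduct A D) :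
  exact_for xi W (Triple (inj1 S) (prj2 S) (0 : E D A)).
Proof.
apply/exact_forP; split.
- by apply: (pc_split hxi) => //; apply: (arlz_zero arlz).
- move=> P _; split=> [t e|c]; last exact: raddf0.
  by rewrite -[t]cmp1m -(prj1_inj1 S) -cmpA e cmpm0.
- move=> Q _; split=> [t e|a]; last exact: raddf0.
  by rewrite -[t]cmpm1 -(prj2_inj2 S) cmpA e cmp0m.
Qed.

(** Composition of deflations preserves relative exactness, and the kernel of
    the composite is a relatively exact extension of the two kernels.  The
    triangles come from (ET4)op; the composite one lies in xi by saturation,
    because its pullback along f is a cobase change of the triangle of g. *)
Lemma exact_for_comp (A B D K F : C) (f : hom B A) (f' : hom D B) (d : E A D)
    (g : hom K B) (g' : hom F K) (d' : E B F) :
  exact_for xi W (Triple f' f d) -> exact_for xi W (Triple g' g d') ->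
  exists (H : C) (h' : hom H K) (d'' : E A H) (u : hom H D) (v : hom F H),
    exact_for xi W (Triple h' (f ∘ g) d'') /\
    exact_for xi W (Triple v u (pull f' d')).
Proof.
move=> /exact_forP[xf fP fQ] /exact_forP[xg gP gQ].
have sf := pc_sub hxi xf; have sg := pc_sub hxi xg.
have [H [h' [d'' [u [v [sh [gh hv] svu _ pfd]]]]]] := etr_ET4op hs sf sg.
exists H, h', d'', u, v; split; apply/exact_forP; split.
- have [M [m [n sM]]] := rlz_ex rlz (pull f d'').
  apply: (pc_saturated hxi sh xf (m := m) (n := n)).
  by rewrite pfd; apply: (pc_cobase hxi xg); rewrite -pfd.
- move=> P WP; have [fI fS] := fP P WP; have [gI gS] := gP P WP; split.
    move=> t ht.
    have ut : u ∘ t = 0 by apply: fI; rewrite cmpA -gh -cmpA ht cmpm0.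
    have [r hr] := lift_inf hs svu ut.
    suff r0 : r = 0 by rewrite hr r0 cmpm0.
    by apply: gI; rewrite -hv -cmpA -hr.
  move=> c; have [c1 <-] := lift_def hs sf (fS c).
  have [c2 <-] := lift_def hs sg (gS c1).
  by rewrite cmpA pull_cmp (pull_def0 hs sh) raddf0.
- move=> Q WQ; have [fI fS] := fQ Q WQ; have [gI gS] := gQ Q WQ; split.
    by move=> t; rewrite cmpA => /gI /fI.
  (* Extend [a ∘ v] along g'; the difference then factors through u, and that
     factor extends along f'. *)
  move=> a; have [e he] := extend_inf hs sg (gS (a ∘ v)).
  have [|r hr] := factor_def hs svu (f := a - e ∘ h').
    by rewrite cmpDl cmpNm -[e ∘ h' ∘ v]cmpA hv he subrr.
  have [r' hr'] := extend_inf hs sf (fS r).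
  have -> : a = (e + r' ∘ g) ∘ h'.
    by rewrite cmpDl -[r' ∘ g ∘ _]cmpA gh cmpA hr' -hr addrC subrK.
  by rewrite push_cmp (push_inf0 hs sh) raddf0.
- by apply: (pc_base hxi xg).
- move=> P WP; have [fI fS] := fP P WP; have [gI gS] := gP P WP; split.
    by move=> t vt; apply: gI; rewrite -hv -cmpA vt cmpm0.
  by move=> c; rewrite -pull_cmp.
- move=> Q WQ; have [fI fS] := fQ Q WQ; have [gI gS] := gQ Q WQ; split.
    (* Extend t along f' to t'; then t' ∘ g kills the kernel of f ∘ g. *)
    move=> t tu; have [t' ht'] := extend_inf hs sf (fS t).
    have [|k hk] := factor_def hs sh (f := t' ∘ g).
      by rewrite -cmpA gh cmpA ht'.
    have t'k : t' = k ∘ f.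
      by apply/subr0_eq/gI; rewrite cmpDl cmpNm hk cmpA subrr.
    by rewrite -ht' t'k -cmpA (def_inf0 hs sf) cmpm0.
  by move=> a; rewrite push_pull gS raddf0.
Qed.

Lemma exact_for_dsum_id (A B D G : C) (x : hom A B) (y : hom B D) (d : E D A)
    (S : biproduct B G) (T : biproduct D G) :
  exact_for xi W (Triple x y d) ->
  exact_for xi W
    (Triple (inj1 S ∘ x) (dsum_hom S T y (idm G)) (pull (prj1 T) d)).
Proof.
move=> /exact_forP[xd dP dQ]; have sd := pc_sub hxi xd.
have sT : s (Triple (inj1 S ∘ x) (dsum_hom S T y (idm G)) (pull (prj1 T) d)).
  have [Z Z0] := has_zero C.
  (* A itself is used as the biproduct of A and 0. *)
  have := arlz_dsum arlz (zero_biproduct A Z0) S T sd (triangle_zero_id hs G Z0).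
  rewrite /dsum_ext /= raddf0 raddf0 addr0 push_id.
  by rewrite {1}/dsum_hom /= cmpm1 cmpm0 addr0.
apply/exact_forP; split.
- exact: (pc_base hxi xd).
- move=> P WP; have [dI dS] := dP P WP; split; last first.
    by move=> c; rewrite -pull_cmp.
  move=> t e; apply: dI.
  by rewrite -[x ∘ t]cmp1m -(prj1_inj1 S) -cmpA [inj1 S ∘ _]cmpA e cmpm0.
- move=> Q WQ; have [dI dS] := dQ Q WQ; split; last first.
    by move=> a; rewrite push_pull dS raddf0.
  move=> t e.
  have t1 : t ∘ inj1 T = 0.
    apply: dI; rewrite -[RHS](cmp0m _ (inj1 S)) -e /dsum_hom.
    rewrite -!cmpA cmpDl -!cmpA prj1_inj1 prj2_inj1.
    by rewrite !cmpm0 addr0 cmpm1.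
  have t2 : t ∘ inj2 T = 0.
    rewrite -[RHS](cmp0m _ (inj2 S)) -e /dsum_hom.
    rewrite -!cmpA cmpDl -!cmpA prj1_inj2 prj2_inj2.
    by rewrite !cmpm0 add0r !cmpm1.
  by rewrite -[t]cmpm1 -(inj_prj T) cmpDr !cmpA t1 t2 !cmp0m addr0.
Qed.

(** Since yb lifts through y, the pullback of y and yb is A + Wb, so that
    A + Wb -> Z is a deflation with kernel B'; precompose it with
    Wa + Wb -> A + Wb. *)
Lemma exact_for_horseshoe (A Z B A' Wa B' Wb : C)
    (x : hom A Z) (y : hom Z B) (d : E B A)
    (xa : hom A' Wa) (ya : hom Wa A) (da : E A A')
    (xb : hom B' Wb) (yb : hom Wb B) (db : E B B') (S : biproduct Wa Wb) :
  W Wb -> exact_for xi W (Triple x y d) ->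
  exact_for xi W (Triple xa ya da) -> exact_for xi W (Triple xb yb db) ->
  exists (Z' : C) (k : hom Z' S) (p : hom S Z) (e : E Z Z')
    (i : hom A' Z') (j : hom Z' B') (e' : E B' A'),
    exact_for xi W (Triple k p e) /\ exact_for xi W (Triple i j e').
Proof.
move=> Wb_W /exact_forP[xd dP dQ] exa /exact_forP[xb' bP bQ].
have sd := pc_sub hxi xd; have sb := pc_sub hxi xb'.
have [T] := has_biproducts A Wb.
have [m [n [smn ni mx yn]]] :=
  triangle_pullback_split hs T sd sb ((dP Wb Wb_W).2 yb).
have exmn : exact_for xi W (Triple m n (pull y db)).
  apply/exact_forP; split.
  - exact: (pc_base hxi xb').
  - move=> P WP; have [bI bS] := bP P WP; split; last first.
      by move=> c; rewrite -pull_cmp.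
    by move=> t mt; apply: bI; rewrite -mx -cmpA mt cmpm0.
  - move=> Q WQ; have [bI bS] := bQ Q WQ; split; last first.
      by move=> a; rewrite push_pull bS raddf0.
    (* A map killed by n vanishes on A, so it factors through y; the factor is
       killed by yb because prj2 T is split epi. *)
    move=> t tn.
    have [|k tk] := factor_def hs sd (f := t).
      by rewrite -ni cmpA tn cmp0m.
    suff k0 : k = 0 by rewrite tk k0 cmp0m.
    apply: bI; rewrite -[yb]cmpm1 -(prj2_inj2 T) [yb ∘ _]cmpA -yn.
    by rewrite !cmpA -tk tn cmp0m.
have [Z' [k [e [j [i [h1 h2]]]]]] :=
  exact_for_comp exmn (exact_for_dsum_id S T exa).
by exists Z', k, (n ∘ dsum_hom S T ya (idm Wb)), e, i, j,
  (pull m (pull (prj1 T) da)).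
Qed.

(** * Left resolved objects *)

(** The class V of the middle term is kept apart from the class W with respect
    to which the triangle is exact: resolutions whose terms are themselves left
    resolved occur along the way. *)
Record presentation (V : C -> Prop) (X X' : C) := Presentation {
  pr_mid : C;
  pr_inf : hom X' pr_mid;
  pr_def : hom pr_mid X;
  pr_ext : E X X';
  pr_in : V pr_mid;
  pr_exact : exact_for xi W (Triple pr_inf pr_def pr_ext)
}.

(** The greatest class whose members are W-exactly presented by an object of W
    with kernel again in the class; a proof exhibits any class K with this
    property. *)
Definition left_resolved (X : C) : Prop :=
  exists2 K : C -> Prop, K X &
    forall Y, K Y -> exists2 Y', K Y' & inhabited (presentation W Y Y').

Lemma left_resolved_step (X : C) :
  left_resolved X -> exists2 X', left_resolved X' & inhabited (presentation W X X').
Proof.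
by move=> [K KX hK]; have [X' KX' pX] := hK X KX; exists X' => //; exists K.
Qed.

Lemma left_resolved_in (X : C) :
  (forall Z : C, is_zero Z -> W Z) -> W X -> left_resolved X.
Proof.
move=> W0 WX; exists W => // Y WY; have [Z Z0] := has_zero C.
exists Z; first exact: W0.
split; exists Y 0 (idm Y) 0 => //.
exact: (exact_for_split (swap_biproduct (zero_biproduct Y Z0))).
Qed.

(** The invariant used to resolve objects one step at a time: kernels of the
    coverings built in [left_resolved_closed] are only iterated extensions of
    the kernels one starts from. *)
Inductive extension_closure (U : C -> Prop) : C -> Prop :=
| ext_in X of U X : extension_closure U X
| ext_ext A Z B (x : hom A Z) (y : hom Z B) (d : E B A) of
    exact_for xi W (Triple x y d) & extension_closure U A
    & extension_closure U B : extension_closure U Z.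

Hypothesis W_dsum : closed_dsum W.

(** Resolutions by left resolved objects can be replaced by resolutions by
    objects of W: each member of the extension closure of U and of the left
    resolved objects is covered with a kernel in that closure, by induction on
    the way in which it is built. *)
Lemma left_resolved_closed (U : C -> Prop) :
  (forall X, U X -> exists2 X', U X' & inhabited (presentation left_resolved X X')) ->
  forall X, U X -> left_resolved X.
Proof.
move=> hU X UX.
exists (extension_closure (fun Y => U Y \/ left_resolved Y)).
  by apply: ext_in; left.
move=> {X UX} X; elim=> {X} [X [UX|lX]|A Z B x y d exd _ [A' KA' pA] _ [B' KB' pB]].
- have [X1 UX1 [[G x y d lG exd]]] := hU X UX.
  have [G' lG' [[W0 x' y' d' WW0 exd']]] := left_resolved_step lG.
  have [X' [h [d'' [u [v [ex1 ex2]]]]]] := exact_for_comp exd exd'.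
  exists X'; last by split; exists W0 h (y ∘ y') d''.
  by apply: (ext_ext ex2); apply: ext_in; [right|left].
- have [X' lX' pX] := left_resolved_step lX; exists X' => //.
  by apply: ext_in; right.
- have [[Wa xa ya da WWa exa]] := pA.
  have [[Wb xb yb db WWb exb]] := pB.
  have [S] := has_biproducts Wa Wb.
  have [Z' [k [p [e [i [j [e' [ex1 ex2]]]]]]]] :=
    exact_for_horseshoe S WWb exd exa exb.
  exists Z'; last by split; exists (bp_ob S) k p e => //; apply: W_dsum.2.
  exact: (ext_ext ex2).
Qed.

(** The complement of a summand of a left resolved object is another such
    summand, so the split triangles Y -> X + Y -> X and X -> X + Y -> Y
    alternate to give resolutions by left resolved objects. *)
Lemma left_resolved_summand (X Y : C) (S : biproduct X Y) :
  left_resolved S -> left_resolved X.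
Proof.
move=> lS.
apply: (left_resolved_closed (U := fun X =>
  exists Y (S : biproduct X Y), left_resolved S)); last by exists Y, S.
move=> {X Y S lS} X [Y [S lS]]; exists Y.
  by exists X, (swap_biproduct S).
split; exists (bp_ob S) (inj2 S) (prj1 S) 0 => //.
exact: (exact_for_split (swap_biproduct S)).
Qed.

End Resolutions.

(** * Duality for proper classes *)
Section Duality.
Variables (C : additiveCat) (E : extBifunctor C) (s xi : triple_class E).
Hypotheses (hs : extriangulated s) (hxi : proper_class s xi).

Lemma iso_triple_sym (T T' : triple E) : iso_triple T T' -> iso_triple T' T.
Proof.
case: T T' => A B D x y d [A' B' D' x' y' d'].
move=> [a [b [c [[[a' [a'a aa']] [[b' [b'b bb']] [c' [c'c cc']]]] /= bx cy ad]]]].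
exists a', b', c'; split=> /=.
- by split; [exists a|split; [exists b|exists c]].
- by rewrite -[x']cmpm1 -aa' [x' ∘ _]cmpA -bx !cmpA b'b cmp1m.
- by rewrite -[y']cmpm1 -bb' [y' ∘ _]cmpA -cy !cmpA c'c cmp1m.
- by rewrite -[d']pull_id -cc' pull_cmp -ad push_pull -push_cmp a'a push_id.
Qed.

(** The dual of saturation.  Embed A in a xi-injective I by i.  Then i extends
    to B2, and push i d1 = 0 because it is pushed out from push x2 d1; so d1 is
    a base change of the triangle of i. *)
Lemma cosaturated (enough : enough_injectives xi) (A B1 D1 B2 D2 M : C)
    (x1 : hom A B1) (y1 : hom B1 D1) (d1 : E D1 A)
    (x2 : hom A B2) (y2 : hom B2 D2) (d2 : E D2 A)
    (m : hom B2 M) (n : hom M D1) :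
  s (Triple x1 y1 d1) -> xi (Triple x2 y2 d2) ->
  xi (Triple m n (push x2 d1)) -> xi (Triple x1 y1 d1).
Proof.
move=> s1 x2d xm; have [I [K [i [p [e [xe Iinj]]]]]] := enough A.
have [_ d20] := (cohom_exactP hs I (pc_sub hxi x2d)).1 (Iinj _ x2d).
have [_ m0] := (cohom_exactP hs I (pc_sub hxi xm)).1 (Iinj _ xm).
have [i' ii'] := extend_inf hs (pc_sub hxi x2d) (d20 i).
have [|c dc] := pull_of_push_eq0 hs s1 (pc_sub hxi xe).
  by rewrite -ii' push_cmp.
by rewrite dc in s1 *; apply: (pc_base hxi xe).
Qed.

Lemma op_proper_class :
  enough_injectives xi -> proper_class (op_class s) (op_class xi).
Proof.
move=> enough; split.
- by move=> T; apply: (pc_sub hxi).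
- move=> T T' sT' [a [b [c [[ai [bi ci]] h1 h2 h3]]]].
  apply: (pc_iso hxi) => //; apply: iso_triple_sym; exists c, b, a; split=> //.
  by split; [|split]; apply/op_is_iso.
- move=> A B D A' B' D' x y d x' y' d' SA SB SD xT xT'.
  rewrite /op_class /unop_triple /=.
  rewrite op_dsum_ext !op_dsum_hom.
  exact: (pc_coprod hxi (unop_biproduct SD) (unop_biproduct SB)
    (unop_biproduct SA) xT xT').
- by move=> T sT T0; apply: (pc_split hxi).
- by move=> *; apply: (pc_cobase hxi); eassumption.
- by move=> *; apply: (pc_base hxi); eassumption.
- move=> A1 B1 A2 B2 M D x1 y1 d1 x2 y2 d2 m n s1 x2d xm.
  exact: (cosaturated enough s1 x2d xm).
Qed.

Lemma op_exact_for (W : C -> Prop) (A B D : C) (x : hom A B) (y : hom B D)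
    (d : E D A) :
  @exact_for (op_cat C) (op_ext E) (op_class xi) W
    (@Triple (op_cat C) (op_ext E) D B A y x d) <->
  exact_for xi W (Triple x y d).
Proof. by split=> -[h1 h2 h3]; split. Qed.

End Duality.

Lemma op_closed_dsum (C : additiveCat) (W : C -> Prop) :
  closed_dsum W -> @closed_dsum (op_cat C) W.
Proof.
move=> [W0 WS]; split=> [Z /op_is_zero/W0 //|A B S].
exact: (WS A B (unop_biproduct S)).
Qed.

(** * Complete resolutions *)

(** Dependent choice turns the one-step property into an actual sequence of
    triangles. *)
Lemma left_resolved_sequence (C : additiveCat) (E : extBifunctor C)
    (xi : triple_class E) (W : C -> Prop) (X : C) :
  left_resolved xi W X -> exists Y : nat -> C,
    inhabited (forall i, presentation xi W W (from0 X Y i) (Y i)).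
Proof.
move=> [K KX hK].
have step (Z : {Z | K Z}) :
    {Z' : {Z | K Z} & presentation xi W W (sval Z) (sval Z')}.
  have [Z' hZ'] : {Z' | K Z' /\ inhabited (presentation xi W W (sval Z) Z')}.
    apply: constructive_indefinite_description.
    by have [Z' KZ' pZ'] := hK _ (svalP Z); exists Z'.
  exists (exist K Z' hZ'.1).
  have [p _] : {p : presentation xi W W (sval Z) Z' | True}.
    by apply: constructive_indefinite_description; case: hZ'.2 => p; exists p.
  exact: p.
pose Z i := iter i (fun Z => projT1 (step Z)) (exist K X KX).
exists (fun i => sval (Z i.+1)); constructor.
by case=> [|i]; [exact: (projT2 (step (Z 0%N)))|exact: (projT2 (step (Z i.+1)))].
Qed.

Section Gorenstein.
Variables (C : additiveCat) (E : extBifunctor C) (s xi : triple_class E).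
Hypotheses (hs : extriangulated s) (hxi : proper_class s xi).

Definition right_resolved (W : C -> Prop) (X : C) : Prop :=
  @left_resolved (op_cat C) (op_ext E) (op_class xi) W X.

(** The two halves of a complete resolution are independent: any resolution and
    any coresolution of X are spliced at X. *)
Lemma GW_left_right (W : C -> Prop) (X : C) :
  GW xi W X <-> left_resolved xi W X /\ right_resolved W X.
Proof.
split=> [[r]|[/left_resolved_sequence[L [lo]]]].
  split.
  - exists (fun Y => exists i, Y = from0 X (cr_lo r) i); first by exists 0%N.
    move=> _ [i ->]; exists (cr_lo r i); first by exists i.+1.
    by split; exists (cx_lo r i) (xlo r i) (ylo r i) (elo r i);
      [apply: cr_Wlo|apply: cr_exact_lo].
  - exists (fun Y => exists i, Y = from0 X (cr_up r) i); first by exists 0%N.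
    move=> _ [i ->]; exists (cr_up r i); first by exists i.+1.
    split; apply: (@Presentation (op_cat C) (op_ext E) (op_class xi) W W _ _
      (cx_up r i) (yup r i) (xup r i) (eup r i)); first exact: cr_Wup.
    exact/op_exact_for/cr_exact_up.
move=> /(left_resolved_sequence (C := op_cat C))[U [up]].
pose xu i : @hom C (from0 X U i) (pr_mid (up i)) := pr_def (up i).
pose yu i : @hom C (pr_mid (up i)) (U i) := pr_inf (up i).
pose eu i : E (U i) (from0 X U i) := pr_ext (up i).
have exu i : exact_for xi W (Triple (xu i) (yu i) (eu i)).
  exact/op_exact_for/(pr_exact (up i)).
have lo0 i : pr_def (lo i) ∘ pr_inf (lo i) = 0.
  by case: (pr_exact (lo i)) => /(pc_sub hxi) /(def_inf0 hs).
have up0 i : yu i ∘ xu i = 0.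
  by case: (exu i) => /(pc_sub hxi) /(def_inf0 hs).
have cmp4_0 (A B D F G : C) (h : hom F G) (g : hom D F) (g' : hom B D)
    (f : hom A B) : g ∘ g' = 0 -> (h ∘ g) ∘ (g' ∘ f) = 0.
  by move=> e; rewrite cmpA -[h ∘ g ∘ g']cmpA e cmpm0 cmp0m.
pose cx : complex C := @Complex C (fun i => pr_mid (lo i)) (fun i => pr_mid (up i))
  (fun i => pr_inf (lo i) ∘ pr_def (lo i.+1))
  (xu 0%N ∘ (pr_def (lo 0) : hom _ X))
  (fun i => xu i.+1 ∘ yu i)
  (fun i => cmp4_0 _ _ _ _ _ _ _ _ _ (lo0 i.+1))
  (cmp4_0 _ _ _ _ _ _ _ _ _ (lo0 0%N))
  (cmp4_0 _ _ _ _ _ _ _ _ _ (up0 0%N))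
  (fun i => cmp4_0 _ _ _ _ _ _ _ _ _ (up0 i.+1)).
split; exists cx L U (fun i => pr_inf (lo i)) (fun i => pr_def (lo i))
  (fun i => pr_ext (lo i)) xu yu eu => // i.
- exact: pr_in.
- exact: (pr_in (up i)).
- exact: pr_exact.
Qed.

Lemma left_resolved_stable (V W : C -> Prop) (X : C) :
  closed_dsum W -> (forall Y, W Y -> V Y) ->
  (forall Y, V Y -> left_resolved xi W Y) ->
  left_resolved xi V X -> left_resolved xi W X.
Proof.
move=> W_dsum WV VlW [K KX hK].
apply: (left_resolved_closed hs hxi W_dsum (U := K)) => // {KX} {}X KX.
have [X' KX' [[G x y d VG [xd hP hQ]]]] := hK X KX; exists X' => //.
split; exists G x y d; first exact: VlW.
by split=> // [P /WV/hP|Q /WV/hQ].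
Qed.

End Gorenstein.

(** * Stability and direct summands *)
Section Stability.
Variables (C : additiveCat) (E : extBifunctor C) (s xi : triple_class E).
Hypotheses (hs : extriangulated s) (hxi : proper_class s xi).
Hypothesis enough : enough_injectives xi.
Variable W : C -> Prop.
Hypothesis W_dsum : closed_dsum W.

Let hs_op := op_extriangulated hs.
Let hxi_op := op_proper_class hs hxi enough.
Let W_dsum_op := op_closed_dsum W_dsum.

(** The resolution is ... -> 0 -> X = X -> 0 -> ... *)
Lemma GW_in (V : C -> Prop) (X : C) :
  (forall Z : C, is_zero Z -> V Z) -> V X -> GW xi V X.
Proof.
move=> V0 VX; apply/(GW_left_right hs hxi); split.
  exact: (left_resolved_in hs hxi V0 VX).
by apply: (left_resolved_in hs_op hxi_op) => // Z /op_is_zero; apply: V0.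
Qed.

Lemma GW_W (X : C) : W X -> GW xi W X.
Proof. by apply: GW_in; case: W_dsum. Qed.

(** A resolution exact relative to V is exact relative to the smaller class W,
    and its terms are left and right resolved by W. *)
Lemma GW_stable (V : C -> Prop) :
  (forall X, V X <-> GW xi W X) -> forall X, GW xi V X <-> GW xi W X.
Proof.
move=> VG X; split=> [/(GW_left_right hs hxi)[lX rX]|GX]; last first.
  by apply: GW_in => [Z Z0|]; apply/VG => //; apply/GW_W/W_dsum.1.
have WV Y : W Y -> V Y by move=> /GW_W; apply: (VG Y).2.
have VW Y : V Y -> left_resolved xi W Y /\ right_resolved xi W Y.
  by move=> /VG /(GW_left_right hs hxi).
apply/(GW_left_right hs hxi); split.
  by apply: (left_resolved_stable hs hxi W_dsum WV _ lX) => Y /VW[].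
by apply: (left_resolved_stable hs_op hxi_op W_dsum_op WV _ rX) => Y /VW[].
Qed.

Lemma GW_iterE (n : nat) (X : C) : GW_iter xi W n.+1 X <-> GW xi W X.
Proof.
elim: n X => [|n IH] X; first by [].
exact: (GW_stable IH X).
Qed.

Lemma GW_summand (X Y : C) (S : biproduct X Y) : GW xi W S -> GW xi W X.
Proof.
move=> /(GW_left_right hs hxi)[lS rS]; apply/(GW_left_right hs hxi); split.
  exact: (left_resolved_summand hs hxi W_dsum lS).
exact: (left_resolved_summand hs_op hxi_op W_dsum_op (S := op_biproduct S) rS).
Qed.

End Stability.

Local Close Scope cat_scope.
Local Close Scope ring_scope.

Theorem theorem4p4 (C : additiveCat) (E : extBifunctor C)
    (s : triple_class E) (s_extri : extriangulated s)
    (xi : triple_class E) (xi_proper : proper_class s xi)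
    (xi_proj : enough_projectives xi) (xi_inj : enough_injectives xi)
    (s_WIC : WIC s)
    (W : C -> Prop) (W_iso : closed_iso W) (W_dsum : closed_dsum W) :
  (forall n : nat, 1 <= n -> forall X : C, GW_iter xi W n X <-> GW xi W X) /\
  closed_summand (GW xi W).
Proof.
split.
  by case=> [//|n] _ X; apply: (GW_iterE s_extri xi_proper xi_inj W_dsum).
move=> A B S GS.
have summand := GW_summand s_extri xi_proper xi_inj W_dsum.
by split; [apply: (summand A B S)|apply: (summand B A (swap_biproduct S))].
Qed.
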